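(* Let $\mathbf{X}$ be a regular two-level design with $n$ factors, and let $B_k$ and $B_k^*$ be the number of defining words of length $k$ of $\mathbf{X}$ and of its double $D(\mathbf{X})$, respectively. Then for each positive integer $k \le 2n$: if $k$ is odd, $$B_k^* = \sum_{s=0}^{\min[(k-1)/2,\,n]} B_{k-2s}\binom{n-k+2s}{s}2^{k-2s-1};$$ if $k$ is even and $k/2$ is even, $$B_k^* = \sum_{s=0}^{\min[k/2-1,\,n]} B_{k-2s}\binom{n-k+2s}{s}2^{k-2s-1} + \binom{n}{k/2};$$ if $k$ is even and $k/2$ is odd, $$B_k^* = \sum_{s=0}^{\min[k/2-1,\,n]} B_{k-2s}\binom{n-k+2s}{s}2^{k-2s-1}.$$
   Context: All designs have two levels, coded $1$ and $-1$. A design with $N$ runs and $n$ factors is an $N\times n$ matrix with entries $\pm 1$; columns correspond to factors and rows to runs. Regular design: a regular $2^{n-p}$ design ($0\le p<n$) is an $N\times n$ matrix with $N = 2^{n-p}$ whose rows are, each once, exactly the vectors $(x_1,\dots,x_n)\in\{1,-1\}^n$ satisfying $p$ equations $\prod_{i\in S_j} x_i = \varepsilon_j$, $j=1,\dots,p$, where $\varepsilon_j\in\{1,-1\}$ and the nonempty subsets $S_j\subseteq\{1,\dots,n\}$ are linearly independent in $\mathbb{F}_2^n$. A defining word is a nonempty set $S$ of factors such that the componentwise product of the corresponding columns is constant; its length is $|S|$. Doubling: the double of an $N\times n$ matrix $\mathbf{X}$ is the $2N\times 2n$ matrix $D(\mathbf{X}) = \begin{bmatrix}\mathbf{X}&\mathbf{X}\\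 \mathbf{X}&-\mathbf{X}\end{bmatrix}$; when $\mathbf{X}$ is regular, so is $D(\mathbf{X})$. Conventions: $B_j = 0$ for $j>n$, and any term containing $B_j$ with $j>n$ is $0$ (whatever the value of the accompanying binomial coefficient). *)

(* Defs.v *)
From HB Require Import structures.
From mathcomp Require Import all_boot all_order all_algebra.
Set Implicit Arguments.
Unset Strict Implicit.
Unset Printing Implicit Defensive.
Import Order.TTheory GRing.Theory Num.Theory.
Local Open Scope ring_scope.

Definition word_indicator_mx (n p : nat) (S : 'I_p -> {set 'I_n}) : 'M['F_2]_(p, n) :=
  \matrix_(j < p, i < n) (i \in S j)%:R.

Definition regular_design (N n p : nat) (X : 'M[int]_(N, n)) : Prop :=
  [/\ (p < n)%N,
      N = (2 ^ (n - p))%N &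
      exists (S : 'I_p -> {set 'I_n}) (eps : 'I_p -> int),
        [/\ forall j, S j != set0 /\ (eps j = 1 \/ eps j = -1),
            row_free (word_indicator_mx S),
            injective (fun r : 'I_N => row r X) &
            forall x : 'rV[int]_n,
              (exists r : 'I_N, row r X = x) <->
              (forall i : 'I_n, x 0 i = 1 \/ x 0 i = -1) /\
              (forall j : 'I_p, \prod_(i in S j) x 0 i = eps j)]].

Definition double_design (N n : nat) (X : 'M[int]_(N, n)) : 'M[int]_(N + N, n + n) :=
  block_mx X X X (- X).

Definition defining_word (N n : nat) (X : 'M[int]_(N, n)) (S : {set 'I_n}) : bool :=
  (S != set0) &&
  [forall r1 : 'I_N, forall r2 : 'I_N,
     \prod_(i in S) X r1 i == \prod_(i in S) X r2 i].

Definition num_words (N n : nat) (X : 'M[int]_(N, n)) (k : nat) : nat :=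
  #|[set S : {set 'I_n} | defining_word X S & #|S| == k]|.

(* The term of index s in the expansion of B_k^*.  The truncated difference
   n + 2s - k departs from n - k + 2s only when k - 2s > n, where
   num_words X (k - 2s) = 0; the other differences do not truncate in the
   ranges of summation in use. *)
Definition double_term (N n : nat) (X : 'M[int]_(N, n)) (k s : nat) : nat :=
  (num_words X (k - 2 * s) * 'C(n + 2 * s - k, s) * 2 ^ (k - 2 * s - 1))%N.

(* Main.v *)
(** Encode a set [T] of columns of the double, made of [A] in the left half and
    [B] in the right half, by the pair [(S, B)], where [S] is the symmetric
    difference of [A] and [B].  Since the entries square to 1, the product of
    the columns in [T] is the product over [S] in the upper rows, and
    [(-1)^|B|] times it in the lower rows; so it is constant iff [S] is empty or
    a defining word and [|B|] is even.  Moreover [|T| = |S| + 2 |B \ S|].  For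
    fixed [S], with [|B \ S| = s], the set [B \ S] is one of the [s]-subsets of
    the complement of [S] and [B] meets [S] in a subset whose parity is that of
    [s]: there are [2^(|S|-1)] of these if [S] is nonempty, and if [S] is empty
    one or none according to the parity of [s]. *)
Require Import Defs.
From HB Require Import structures.
From mathcomp Require Import all_boot all_order all_algebra.
From mathcomp Require Import zify.
Set Implicit Arguments.
Unset Strict Implicit.
Unset Printing Implicit Defensive.

(** Fix [x] in [S]. Each subset [D] of [S :\ x] extends to exactly one subset of [S] of the
    prescribed parity, namely [D] or [x |: D]; this is [h D], and removing [x] inverts it. *)
Lemma card_subsets_parity (I : finType) (S : {set I}) (b : bool) :
  S != set0 ->
  #|[set E : {set I} | (E \subset S) && (odd #|E| == b)]| = 2 ^ (#|S| - 1).
Proof.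
case/set0Pn=> x xS; pose h (D : {set I}) := if odd #|D| == b then D else x |: D.
have hD (D : {set I}) : h D :\ x = D :\ x.
  by rewrite /h; case: ifP => // _; apply/setP=> y; rewrite !inE; case: eqP.
have -> : [set E : {set I} | (E \subset S) && (odd #|E| == b)]
          = h @: powerset (S :\ x).
  apply/setP=> E; rewrite inE; apply/andP/imsetP.
  - case=> ES /eqP oE; exists (E :\ x); first by rewrite inE setSD.
    rewrite /h; have := cardsD1 x E; case: (boolP (x \in E)) => xE cE.
      rewrite setD1K //; case: eqP => // oD.
      by move: oE oD; rewrite cE /= => <-; case: odd.
    have -> : E :\ x = E.
      by apply/setP=> y; rewrite !inE; case: eqP => // ->; rewrite (negbTE xE).
    by rewrite oE eqxx.
  - case=> D; rewrite inE subsetD1 => /andP[DS xD] ->; rewrite /h.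
    case: ifP => [-> //|oD]; rewrite subUset sub1set xS DS cardsU1 xD /=.
    by split=> //; move: oD; case: odd; case: (b).
rewrite card_in_imset ?card_powerset ?[in RHS](cardsD1 x S) ?xS ?add1n ?subn1 //.
move=> D E; rewrite !inE !subsetD1 => /andP[_ xD] /andP[_ xE].
move/(congr1 (fun F => F :\ x)).
rewrite !hD => /setP DE; apply/setP=> y; have := DE y.
by rewrite !inE; case: eqP => [->|//]; rewrite (negbTE xD) (negbTE xE).
Qed.

Lemma card_even_with_outer_part (I : finType) (S : {set I}) (s : nat) :
  #|[set B : {set I} | (#|B :\: S| == s) && ~~ odd #|B|]|
  = 'C(#|I| - #|S|, s)
    * #|[set E : {set I} | (E \subset S) && (odd #|E| == odd s)]|.
Proof.
have -> : #|I| - #|S| = #|~: S| by rewrite -(cardsC S) addKn.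
rewrite -cards_draws -cardsX; set Y := setX _ _.
pose f (u : {set I} * {set I}) := u.1 :|: u.2.
(* One component lies outside [S] and the other inside, so both can be read off from their union;
   hence [f] is injective on [Y]. *)
have fD u : u \in Y -> f u :\: S = u.1.
  case: u => C E; rewrite !inE /= => /andP[/andP[CS _] /andP[ES _]].
  apply/setP=> y; rewrite !inE /=.
  by have /implyP := subsetP CS y; have /implyP := subsetP ES y; rewrite !inE; do 3!case: (y \in _).
have fI u : u \in Y -> f u :&: S = u.2.
  case: u => C E; rewrite !inE /= => /andP[/andP[CS _] /andP[ES _]].
  apply/setP=> y; rewrite !inE /=.
  by have /implyP := subsetP CS y; have /implyP := subsetP ES y; rewrite !inE; do 3!case: (y \in _).
have fcard (B : {set I}) : odd #|B| = odd #|B :\: S| (+) odd #|B :&: S|.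
  by rewrite -(cardsID S B) addnC oddD.
rewrite -(@card_in_imset _ _ f); last first.
  by move=> u v uY vY e; rewrite [u]surjective_pairing [v]surjective_pairing
    -(fD u) // -(fI u) // e fD // fI.
apply: eq_card => B; rewrite inE fcard; apply/andP/imsetP.
- case=> /eqP cD oD; exists (B :\: S, B :&: S); last by rewrite /f /= setUC setID.
  rewrite !inE /= cD eqxx subsetIr subsetDr //=.
  by move: oD; rewrite cD; case: odd; case: odd.
- case=> u uY ->; rewrite fD // fI //; move: uY; rewrite !inE.
  by case/andP=> /andP[_ /eqP ->] /andP[_ /eqP ->]; rewrite eqxx addbb.
Qed.

Section HalfDecomposition.
Variable n : nat.

Definition right_part (T : {set 'I_(n + n)}) := [set i : 'I_n | rshift n i \in T].
Definition sym_part (T : {set 'I_(n + n)}) :=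
  [set i : 'I_n | (lshift n i \in T) (+) (rshift n i \in T)].
(** The inverse of the encoding: the left half is recovered as the symmetric difference of [S] and
    [B]. *)
Definition join_parts (u : {set 'I_n} * {set 'I_n}) : {set 'I_(n + n)} :=
  [set i | match split i with
           | inl j => (j \in u.1) (+) (j \in u.2)
           | inr j => j \in u.2
           end].

Lemma mem_join_partsl u i :
  (lshift n i \in join_parts u) = (i \in u.1) (+) (i \in u.2).
Proof. by rewrite inE (unsplitK (inl i)). Qed.

Lemma mem_join_partsr u i : (rshift n i \in join_parts u) = (i \in u.2).
Proof. by rewrite inE (unsplitK (inr i)). Qed.

Lemma join_partsK u : (sym_part (join_parts u), right_part (join_parts u)) = u.
Proof.
case: u => S B; congr (_, _); apply/setP=> i;
  rewrite inE ?mem_join_partsl mem_join_partsr //.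
by rewrite -addbA addbb addbF.
Qed.

Lemma parts_joinK T : join_parts (sym_part T, right_part T) = T.
Proof.
apply/setP=> i; rewrite -(splitK i); case: (split i) => j /=.
  by rewrite mem_join_partsl !inE -addbA addbb addbF.
by rewrite mem_join_partsr inE.
Qed.

Lemma card_sym_right (T : {set _}) : #|T| = #|sym_part T| + 2 * #|right_part T :\: sym_part T|.
Proof.
rewrite mul2n -addnn -!sum1_card !(big_mkcond (fun i => i \in _)) big_split_ord /= -!big_split /=.
by apply: eq_bigr => i _; rewrite !inE; case: (lshift n i \in T); case: (rshift n i \in T).
Qed.

End HalfDecomposition.

Section DoubleWords.
Local Open Scope ring_scope.
Import GRing.Theory Num.Theory.
Variables (N n : nat) (X : 'M[int]_(N, n)).
Hypothesis X_sign : forall r i, X r i = 1 \/ X r i = -1.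

(** Unlike [defining_word], this admits the empty set, which as a symmetric part accounts for the
    extra binomial coefficient. *)
Definition constant_product (N' n' : nat) (Y : 'M[int]_(N', n')) (S : {set 'I_n'}) :=
  [forall r1, forall r2, \prod_(i in S) Y r1 i == \prod_(i in S) Y r2 i].

Lemma prod_double_up (T : {set _}) r :
  \prod_(i in T) double_design X (lshift N r) i = \prod_(i in sym_part T) X r i.
Proof.
rewrite !(big_mkcond (fun i => i \in _)) big_split_ord /= -big_split /=.
apply: eq_bigr => i _; rewrite /double_design block_mxEul block_mxEur inE.
by case: (_ \in T); case: (_ \in T); rewrite ?mulr1 ?mul1r //=; case: (X_sign r i) => ->.
Qed.

Lemma prod_double_down (T : {set _}) r :
  \prod_(i in T) double_design X (rshift N r) i
  = (-1) ^+ #|right_part T| * \prod_(i in sym_part T) X r i.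
Proof.
rewrite -prodr_const !(big_mkcond (fun i => i \in _)) big_split_ord /= -!big_split /=.
apply: eq_bigr => i _; rewrite /double_design block_mxEdl block_mxEdr mxE !inE.
by case: (_ \in T); case: (_ \in T); rewrite ?mulr1 ?mul1r //=; case: (X_sign r i) => ->.
Qed.

Lemma prod_sign_neq0 (S : {set 'I_n}) r : \prod_(i in S) X r i != 0.
Proof. by apply/prodf_neq0 => i _; case: (X_sign r i) => ->. Qed.

Lemma constant_product_double (T : {set _}) : (0 < N)%N ->
  constant_product (double_design X) T
  = constant_product X (sym_part T) && ~~ odd #|right_part T|.
Proof.
move=> N0; have r0 : 'I_N := Ordinal N0.
apply/idP/andP.
- move/forallP=> c; have {}c r1 r2 := eqP (forallP (c r1) r2); split.
    apply/forallP=> r1; apply/forallP=> r2.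
    by rewrite -!prod_double_up; apply/eqP.
  (* Upper and lower copies of one row: an odd right part would make the product equal to its own
     negative, hence zero. *)
  have := c (lshift N r0) (rshift N r0).
  rewrite prod_double_up prod_double_down -signr_odd; case: odd => //= /eqP.
  rewrite expr1 mulN1r -addr_eq0 -mulr2n mulrn_eq0 /=.
  by rewrite (negbTE (prod_sign_neq0 _ _)).
- case=> /forallP c ev; have {}c r1 r2 := eqP (forallP (c r1) r2).
  apply/forallP=> r1; apply/forallP=> r2; apply/eqP.
  rewrite -(splitK r1) -(splitK r2).
  by case: (split r1) => ?; case: (split r2) => ? /=;
    rewrite ?prod_double_up ?prod_double_down -?(signr_odd _ #|_|) ?(negbTE ev) ?mul1r.
Qed.

End DoubleWords.

Lemma num_words_double (N n : nat) (X : 'M[int]_(N, n)) (k : nat) :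
  (forall r i, X r i = 1%R \/ X r i = (-1)%R) -> 0 < N -> 0 < k ->
  num_words (double_design X) k =
  \sum_(S : {set 'I_n} | constant_product X S)
    #|[set B : {set 'I_n} | (#|S| + 2 * #|B :\: S| == k) && ~~ odd #|B|]|.
Proof.
move=> Xs N0 k0; rewrite /num_words -sum1_card.
under [RHS]eq_bigr => S _ do rewrite -sum1_card.
rewrite pair_big_dep /= (reindex_onto (fun T => (sym_part T, right_part T)) (@join_parts n)) /=;
  last by move=> u _; exact: join_partsK.
apply: eq_bigl => T; rewrite !inE parts_joinK eqxx andbT -card_sym_right andbCA.
rewrite /defining_word -[[forall r1, _]]/(constant_product (double_design X) T).
rewrite constant_product_double // -card_gt0.
(* A set of size [k > 0] is nonempty, so that condition of [defining_word] is automatic. *)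
by case: eqP => [->|]; rewrite ?k0 ?andbT ?andbF //=; case: constant_product.
Qed.

(** At most one [s] satisfies the condition. Writing the count as a sum over [s] allows an exchange
    with the sum over [S]; the range ends at [(k - 1) %/ 2] because [S] has at least one element. *)
Lemma card_even_with_weight (I : finType) (S : {set I}) (k : nat) :
  S != set0 ->
  #|[set B : {set I} | (#|S| + 2 * #|B :\: S| == k) && ~~ odd #|B|]|
  = \sum_(s < ((k - 1) %/ 2).+1 | #|S| == k - 2 * s)
      'C(#|I| + 2 * s - k, s) * 2 ^ (k - 2 * s - 1).
Proof.
move=> S0; set M := (k - 1) %/ 2.
have Sgt0 : 0 < #|S| by rewrite card_gt0.
have bound (B : {set I}) : #|S| + 2 * #|B :\: S| = k -> #|B :\: S| < M.+1.
  by rewrite /M; move: #|S| #|B :\: S| Sgt0; lia.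
(* By [bound], the default value of [inord] never occurs on the sets counted. *)
rewrite -sum1_card (partition_big (fun B => inord #|B :\: S| : 'I_M.+1)
  (fun s : 'I_M.+1 => #|S| == k - 2 * s)) /=; last first.
  by move=> B; rewrite inE => /andP[/eqP e _]; rewrite inordK ?bound // -e addnK.
apply: eq_bigr => s /eqP cS.
have ks : #|S| + 2 * s = k by rewrite cS subnK //; move: cS Sgt0; lia.
have -> : #|I| + 2 * s - k = #|I| - #|S| by rewrite -ks subnDr.
rewrite -cS -(card_subsets_parity (odd s) S0) -card_even_with_outer_part sum1dep_card.
apply: eq_card => B; rewrite !inE andbAC; congr (_ && _).
apply/andP/eqP => [[/eqP e /eqP <-]|e]; first by rewrite inordK ?bound.
by rewrite e inord_val ks !eqxx.
Qed.

Lemma sum_double_term (N n : nat) (X : 'M[int]_(N, n)) (k : nat) :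
  \sum_(S : {set 'I_n} | defining_word X S)
    #|[set B : {set 'I_n} | (#|S| + 2 * #|B :\: S| == k) && ~~ odd #|B|]|
  = \sum_(0 <= s < ((k - 1) %/ 2).+1) double_term X k s.
Proof.
rewrite big_mkord.
under eq_bigr => S /andP[S0 _] do rewrite card_even_with_weight // card_ord.
rewrite (exchange_big_dep predT) //=; apply: eq_bigr => s _.
rewrite sum_nat_const /double_term mulnA; congr (_ * _ * _).
by rewrite /num_words; apply: eq_card => S; rewrite !inE.
Qed.

Theorem theorem2p3 (N n p : nat) (X : 'M[int]_(N, n))
    (hX : regular_design p X) (k : nat) (hk0 : 0 < k) (hk : k <= 2 * n) :
  [/\ odd k ->
        num_words (double_design X) k =
        \sum_(0 <= s < (minn ((k - 1) %/ 2) n).+1) double_term X k s,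
      ~~ odd k -> ~~ odd (k %/ 2) ->
        num_words (double_design X) k =
        \sum_(0 <= s < (minn (k %/ 2 - 1) n).+1) double_term X k s
          + 'C(n, k %/ 2) &
      ~~ odd k -> odd (k %/ 2) ->
        num_words (double_design X) k =
        \sum_(0 <= s < (minn (k %/ 2 - 1) n).+1) double_term X k s].
Proof.
case: hX => _ NE [Sp [eps [_ _ _ rows]]].
have N0 : 0 < N by rewrite NE expn_gt0.
have Xs r i : X r i = 1%R \/ X r i = (-1)%R.
  have [/(_ (ex_intro _ r erefl)) [/(_ i)]] := rows (row r X).
  by rewrite mxE.
(* The first summand is the contribution of the empty symmetric part, the second that of the
   defining words of [X]. *)
have main : num_words (double_design X) k =
    #|[set B : {set 'I_n} | (2 * #|B| == k) && ~~ odd #|B|]|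
    + \sum_(0 <= s < ((k - 1) %/ 2).+1) double_term X k s.
  rewrite num_words_double // (bigD1 set0) /=; last first.
    by apply/forallP=> r1; apply/forallP=> r2; rewrite !big_set0.
  rewrite -sum_double_term; congr (_ + _).
    by apply: eq_card => B; rewrite !inE cards0 setD0.
  by apply: eq_bigl => S; rewrite andbC.
split=> [ok|ek ek2|ek ok2]; rewrite main.
(* Since [k <= 2 * n], the cap [n] is inactive, and [k %/ 2 - 1] is [(k - 1) %/ 2] for even [k]. The
   cases thus differ only in the first summand, which counts subsets of even size [k / 2]. *)
- have -> : minn ((k - 1) %/ 2) n = (k - 1) %/ 2 by lia.
  rewrite [X in X + _](_ : _ = 0) //; apply: eq_card0 => B; rewrite !inE.
  by case: eqP => // e; move: ok; rewrite -e mul2n odd_double.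
- have -> : minn (k %/ 2 - 1) n = (k - 1) %/ 2 by lia.
  rewrite addnC; congr (_ + _); rewrite -[in RHS](card_ord n) -card_draws.
  apply: eq_card => B; rewrite !inE; apply/andP/eqP => [[/eqP e _]|e]; first by rewrite -e mulKn.
  by rewrite e; split=> //; apply/eqP; lia.
- have -> : minn (k %/ 2 - 1) n = (k - 1) %/ 2 by lia.
  rewrite [X in X + _](_ : _ = 0) //; apply: eq_card0 => B; rewrite !inE.
  by case: eqP => // e; move: ok2; rewrite -e mulKn // => ->.
Qed.
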